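(* Let $G$ be a connected graph of order $n\geq2$ with Wiener index $W$. Then $$\partial^Q_n(G)\leq\frac{2W}{n}-1.$$ Moreover, if $G\cong K_n$, then equality holds.
   Context: All graphs are finite, simple, undirected and connected; $d(u,v)$ is graph distance and $W(G)=\frac12\sum_{u,v}d(u,v)$ is the Wiener index. The transmission of $v$ is $Tr(v)=\sum_u d(v,u)$; $Tr(G)$ is the diagonal matrix of transmissions, $D(G)$ the distance matrix, and $\mathcal{Q}(G)=Tr(G)+D(G)$ the distance signless Laplacian matrix with eigenvalues $\partial^Q_1(G)\geq\cdots\geq\partial^Q_n(G)$. *)

(* Defs.v *)
From HB Require Import structures.
From mathcomp Require Import all_boot all_order all_algebra.
From mathcomp Require Import polyrcf.

Set Implicit Arguments.
Unset Strict Implicit.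
Unset Printing Implicit Defensive.

Import Order.TTheory GRing.Theory Num.Theory.

Local Open Scope ring_scope.

Record sgraph := SGraph {
  vertex :> finType;
  adj : rel vertex;
  adj_sym : symmetric adj;
  adj_irr : irreflexive adj
}.

Definition connected (G : sgraph) : Prop :=
  forall u v : G, connect (@adj G) u v.

Definition is_upath (G : sgraph) (u v : G) (p : seq G) : bool :=
  [&& path (@adj G) u p, uniq (u :: p) & last u p == v].

(* The length of a shortest path from u to v. A path has fewer than #|G|
   edges, so searching 0, ..., #|G|.-1 is enough; the value is #|G| when no
   path exists. *)
Definition dist (G : sgraph) (u v : G) : nat :=
  find (fun k => [exists p : k.-tuple G, is_upath u v p]) (iota 0 #|G|).

Definition transmission (G : sgraph) (v : G) : nat :=
  (\sum_(u : G) dist v u)%N.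

Definition wiener (R : rcfType) (G : sgraph) : R :=
  2^-1 * \sum_(u : G) \sum_(v : G) (dist u v)%:R.

Definition dist_mx (R : rcfType) (G : sgraph) : 'M[R]_#|G| :=
  \matrix_(i, j) (dist (enum_val i) (enum_val j))%:R.

Definition transmission_mx (R : rcfType) (G : sgraph) : 'M[R]_#|G| :=
  diag_mx (\row_i (transmission (enum_val i))%:R).

Definition dist_signless_laplacian (R : rcfType) (G : sgraph) : 'M[R]_#|G| :=
  transmission_mx R G + dist_mx R G.

(* The eigenvalues lying in R, in nonincreasing order, each repeated according
   to its algebraic multiplicity; for a symmetric n x n matrix over a real
   closed field these are all n eigenvalues. *)
Definition spectrum (R : rcfType) (n : nat) (A : 'M[R]_n) : seq R :=
  sort >=%R
    (flatten [seq nseq (mup a (char_poly A)) a | a <- rootsR (char_poly A)]).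

(* Eigenvalues are numbered from 1. *)
Definition dist_Q_eigenvalue (R : rcfType) (G : sgraph) (i : nat) : R :=
  nth 0 (spectrum (dist_signless_laplacian R G)) i.-1.

Definition sg_iso (G H : sgraph) : Prop :=
  exists2 f : G -> H, bijective f & forall u v : G, adj (f u) (f v) = adj u v.

Lemma complete_sym n : symmetric (fun i j : 'I_n => i != j).
Proof. by move=> i j; rewrite eq_sym. Qed.

Lemma complete_irr n : irreflexive (fun i j : 'I_n => i != j).
Proof. by move=> i; rewrite eqxx. Qed.

Definition complete_graph (n : nat) : sgraph :=
  SGraph (@complete_sym n) (@complete_irr n).

(* Main.v *)
Require Import Defs.
From mathcomp Require Import all_boot all_order all_algebra.
From mathcomp Require Import polyrcf complex spectral.
From mathcomp Require Import ring lra.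

Set Implicit Arguments.
Unset Strict Implicit.
Unset Printing Implicit Defensive.

Import Order.TTheory GRing.Theory Num.Theory.

Local Open Scope ring_scope.

(* Write m for the least eigenvalue of Q and T_i for the transmissions.  The
   Rayleigh quotient of e_i - e_j gives 2m <= T_i + T_j - 2 d(i,j), which is at
   most T_i + T_j - 2 when i <> j.  Summing over the pairs (i, i + 1), taken
   cyclically, yields 2nm <= 4W - 2n.  For K_n, an eigenvector v satisfies
   (m - (n - 2)) v_j = sum_i v_i for every j, which forces m = n - 2 or
   m = 2n - 2. *)

(** * Characteristic polynomials and the spectrum as a multiset *)

Lemma mup_prod_XsubC (R : fieldType) (s : seq R) (x : R) :
  mup x (\prod_(a <- s) ('X - a%:P)) = count_mem x s.
Proof.
elim: s => [|a s IHs]; first by rewrite big_nil /= mupNroot // root1.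
rewrite big_cons mupM ?polyXsubC_eq0 //; last first.
  by rewrite monic_neq0 ?monic_prod_XsubC.
by rewrite IHs -['X - a%:P]expr1 mup_XsubCX /=; case: (a == x).
Qed.

(** Scalar matrices commute with [PX], so conjugating [D] by [P] conjugates the whole characteristic
    matrix over the polynomial ring. *)
Lemma char_poly_conj (R : comUnitRingType) (n : nat) (P D : 'M[R]_n) :
  P \in unitmx -> char_poly (invmx P *m D *m P) = char_poly D.
Proof.
move=> Pu; rewrite /char_poly /char_poly_mx.
set PX := map_mx (@polyC R) P; set QX := map_mx (@polyC R) (invmx P).
have QP : QX *m PX = 1%:M by rewrite -map_mxM mulVmx ?map_mx1.
have -> : 'X%:M - map_mx polyC (invmx P *m D *m P) =
          QX *m ('X%:M - map_mx polyC D) *m PX.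
  rewrite mulmxBr mulmxBl !map_mxM; congr (_ - _).
  by rewrite scalar_mxC -mulmxA QP mulmx1.
by rewrite !det_mulmx mulrAC -det_mulmx QP det1 mul1r.
Qed.

(** Each [x] occurs on both sides as often as its multiplicity as a root of [char_poly A]. This
    identifies [spectrum] with the eigenvalues found by diagonalisation. *)
Lemma spectrum_perm (R : rcfType) (n : nat) (A : 'M[R]_n) (s : seq R) :
  char_poly A = \prod_(x <- s) ('X - x%:P) -> perm_eq (spectrum A) s.
Proof.
move=> As; rewrite /spectrum perm_sort; apply/allP => x _ /=; apply/eqP.
have p0 : char_poly A != 0 by rewrite monic_neq0 ?char_poly_monic.
rewrite count_flatten -map_comp -(mup_prod_XsubC s) -As.
under eq_map => a do rewrite /= count_nseq /=.
rewrite sumnE big_map.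
have [rx|nrx] := boolP (root (char_poly A) x); last first.
  rewrite mupNroot // big1_seq // => a /andP[_].
  rewrite -(roots_on_rootsR p0) inE /= => ra.
  by case: eqP nrx => // <-; rewrite ra.
rewrite (bigD1_seq x) ?uniq_roots -?(roots_on_rootsR p0) //= eqxx mul1n.
rewrite big1 ?addn0 //.
by move=> a /negbTE->.
Qed.

(** * Spectral theorem and Rayleigh bound for symmetric matrices *)

Local Open Scope sesquilinear_scope.

(* Diagonalises [A] unitarily over [R[i]]; the weight [w i] is the squared
   modulus of the i-th coordinate of [v] in an eigenbasis. *)
Lemma symmetric_spectral (R : rcfType) (n : nat) (A : 'M[R]_n) :
  A^T = A -> exists2 d : 'I_n -> R,
    char_poly A = \prod_(i < n) ('X - (d i)%:P) &
    forall v : 'rV[R]_n, exists w : 'I_n -> R,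
      [/\ forall i, 0 <= w i,
          (v *m v^T) 0 0 = \sum_i w i &
          (v *m A *m v^T) 0 0 = \sum_i d i * w i].
Proof.
move=> Asym; pose toC : {rmorphism R -> R[i]} := real_complex R.
have toC_real x : toC x \is Num.real by apply/complex_realP; exists x.
pose B := map_mx toC A.
have Bherm : B \is hermsymmx.
  apply: realsym_hermsym; last by apply/mxOverP => i j; rewrite mxE.
  by apply/is_hermitianmxP; rewrite /= expr0 scale1r map_mx_id // /B map_trmx Asym.
have BE := orthomx_spectralP (hermitian_normalmx Bherm).
have dreal := mxOverP (hermitian_spectral_diag_real Bherm) 0.
set D := spectral_diag B in BE dreal; set P := spectralmx B in BE.
have Pun : P \is unitarymx by apply: spectral_unitarymx.
have Pu := unitarymx_unit Pun; rewrite invmx_unitary // in BE.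
have dE i : toC (complex.Re (D 0 i)) = D 0 i by apply: RRe_real.
exists (fun i => complex.Re (D 0 i)).
  (* The factorisation is checked over [R[i]], where [B] is similar to [diag_mx D], whose entries
     are real. *)
  apply: (map_poly_inj toC); rewrite map_char_poly -/B BE -invmx_unitary //.
  rewrite char_poly_conj // char_poly_trig ?diag_mx_is_trig // rmorph_prod.
  apply: eq_bigr => i _.
  by rewrite /= rmorphB /= map_polyX map_polyC /= dE mxE eqxx mulr1n.
(* The entries of [u] are the coordinates of [v] in the orthonormal eigenbasis formed by the rows of
   [P]. *)
move=> v; pose u := map_mx toC v *m P^t*.
have vtC : map_mx toC v^T = (map_mx toC v)^t*.
  by apply/matrixP => i j; rewrite !mxE; symmetry; apply/CrealP.
have utC : u^t* = P *m map_mx toC v^T.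
  by rewrite /u trmx_mul map_mxM trmxCK vtC.
have PP : P^t* *m P = 1%:M by rewrite -invmx_unitary // mulVmx.
have wE i : toC (complex.Re (`|u 0 i| ^+ 2)) = `|u 0 i| ^+ 2.
  by apply: RRe_real; rewrite rpredX ?normr_real.
exists (fun i => complex.Re (`|u 0 i| ^+ 2)); split.
- by move=> i; rewrite -ler0c wE exprn_ge0.
- apply: (fmorph_inj toC); rewrite [RHS]rmorph_sum.
  have -> : toC ((v *m v^T) 0 0) = (u *m u^t*) 0 0.
    by rewrite utC /u mulmxA -[_ *m P]mulmxA PP mulmx1 -map_mxM [RHS]mxE.
  rewrite mxE; apply: eq_bigr => i _.
  by rewrite wE !mxE normCK.
- apply: (fmorph_inj toC); rewrite [RHS]rmorph_sum.
  have -> : toC ((v *m A *m v^T) 0 0) = (u *m diag_mx D *m u^t*) 0 0.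
    transitivity ((map_mx toC (v *m A *m v^T)) 0 0); first by rewrite [RHS]mxE.
    by rewrite !map_mxM -/B BE utC /u !mulmxA.
  rewrite mxE; apply: eq_bigr => i _.
  rewrite rmorphM /= dE wE mul_mx_diag !mxE normCK; ring.
Qed.

(** The list is nonincreasing, so its last entry [m] is below every [d i]; as the weights are
    nonnegative, m * sum w_i <= sum d_i w_i. *)
Lemma least_eigenvalue (R : rcfType) (n : nat) (A : 'M[R]_n) :
  A^T = A -> (0 < n)%N -> let m := nth 0 (spectrum A) n.-1 in
  eigenvalue A m /\
  forall v : 'rV[R]_n, m * (v *m v^T) 0 0 <= (v *m A *m v^T) 0 0.
Proof.
move=> /symmetric_spectral[d dA quadA] n_gt0 m.
have spP : perm_eq (spectrum A) (codom d).
  by apply: spectrum_perm; rewrite dA codomE big_map big_enum.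
have szs : size (spectrum A) = n by rewrite (perm_size spP) size_codom card_ord.
have ltn1 : (n.-1 < n)%N by rewrite prednK.
have m_in : m \in spectrum A by rewrite mem_nth ?szs.
have m_le i : m <= d i.
  have : d i \in spectrum A by rewrite (perm_mem spP) codom_f.
  move=> /(nthP 0)[k]; rewrite szs => ltk <-.
  have srt : sorted >=%R (spectrum A).
    by apply: sort_sorted => x y; rewrite /= orbC le_total.
  have tr : transitive (>=%R : rel R).
    by move=> x y z xy yz; apply: le_trans yz xy.
  apply: (sorted_leq_nth tr _ 0 srt) => [x|||]; rewrite ?inE ?szs //=.
  by rewrite -ltnS prednK.
split.
  rewrite eigenvalue_root_char dA.
  move: m_in; rewrite (perm_mem spP) => /codomP[i ->].
  by rewrite (bigD1 i) //= rootM root_XsubC eqxx.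
move=> v; have [w [w_ge0 -> ->]] := quadA v.
by rewrite mulr_sumr; apply: ler_sum => i _; rewrite ler_wpM2r.
Qed.

Local Close Scope sesquilinear_scope.

(** The Rayleigh bound is applied to e_i - e_j, whose squared norm is 2. *)
Lemma least_eigenvalue_pair (R : rcfType) (n : nat) (A : 'M[R]_n) (i j : 'I_n) :
  A^T = A -> i != j ->
  nth 0 (spectrum A) n.-1 * 2 <= A i i + A j j - A i j * 2.
Proof.
move=> Asym neq_ij; have n_gt0 : (0 < n)%N by apply: leq_ltn_trans (ltn_ord i).
have [_ /(_ (delta_mx 0 i - delta_mx 0 j))] := least_eigenvalue Asym n_gt0.
have Aji : A j i = A i j by rewrite -[in LHS]Asym mxE.
rewrite !linearB /= !mulmxBl !trmx_delta -!rowE -!colE !mxE Aji.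
rewrite !eqxx (eq_sym j) (negbTE neq_ij) /=; lra.
Qed.

(** * Graph distance *)

(** The search stops at length 0 only if the empty path, which ends at [u], also ends at [v]. *)
Lemma dist_gt0 (G : sgraph) (u v : G) : u != v -> (0 < dist u v)%N.
Proof.
move=> neq_uv; rewrite /dist.
have : (0 < #|G|)%N by apply/card_gt0P; exists u.
case: #|G| => // k _ /=; case: ifP => // /existsP[p].
by rewrite tuple0 /is_upath /= (negbTE neq_uv).
Qed.

Lemma distxx (G : sgraph) (u : G) : dist u u = 0%N.
Proof.
rewrite /dist; have : (0 < #|G|)%N by apply/card_gt0P; exists u.
case: #|G| => // k _ /=; case: ifP => // /negbT/existsP[].
by exists [tuple]; rewrite /is_upath /= eqxx.
Qed.

Lemma dist_adj (G : sgraph) (u v : G) : adj u v -> dist u v = 1%N.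
Proof.
move=> uv; have neq_uv : u != v by apply: contraTneq uv => ->; rewrite adj_irr.
(* The search range [iota 0 #|G|] must contain length 1. *)
have lt1 : (1 < #|G|)%N by apply/card_gt1P; exists u, v.
have := dist_gt0 neq_uv; rewrite /dist.
case: #|G| lt1 => [|[|k]] //= _; case: ifP => // _ _; case: ifP => // /negbT/existsP[].
by exists [tuple v]; rewrite /is_upath /= uv eqxx inE neq_uv.
Qed.

Lemma is_upath_rev (G : sgraph) (u v : G) (p : seq G) :
  is_upath u v p -> is_upath v u (rev (belast u p)).
Proof.
move=> /and3P[pth unq /eqP lst].
have E : v :: rev (belast u p) = rev (u :: p) by rewrite [in RHS]lastI lst rev_rcons.
apply/and3P; split.
- rewrite -lst rev_path; have := pth.
  by rewrite (eq_path (e' := fun z => (@adj G)^~ z)) // => x y; rewrite adj_sym.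
- by rewrite E rev_uniq.
- by have := congr1 (last v) E; rewrite rev_cons last_rcons /= => ->.
Qed.

(** Reversal preserves length, so both searches test equivalent predicates. *)
Lemma distC (G : sgraph) (u v : G) : dist u v = dist v u.
Proof.
rewrite /dist; apply: eq_find => k.
suff half x y : [exists p : k.-tuple G, is_upath x y p] ->
                [exists p : k.-tuple G, is_upath y x p] by apply/idP/idP; apply: half.
move=> /existsP[p /is_upath_rev H].
have sz : size (rev (belast x p)) == k by rewrite size_rev size_belast size_tuple.
by apply/existsP; exists (Tuple sz).
Qed.

(** * The distance signless Laplacian and the upper bound *)

Lemma wienerE (R : rcfType) (G : sgraph) :
  2 * wiener R G = \sum_(u : G) (transmission u)%:R.
Proof.
rewrite /wiener mulrA mulfV ?pnatr_eq0 // mul1r.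
by apply: eq_bigr => u _; rewrite /transmission natr_sum.
Qed.

Lemma dist_signless_laplacianE (R : rcfType) (G : sgraph) (i j : 'I_#|G|) :
  dist_signless_laplacian R G i j =
  (transmission (enum_val i))%:R *+ (i == j) + (dist (enum_val i) (enum_val j))%:R.
Proof. by rewrite !mxE. Qed.

Lemma dist_signless_laplacian_sym (R : rcfType) (G : sgraph) :
  (dist_signless_laplacian R G)^T = dist_signless_laplacian R G.
Proof.
apply/matrixP => i j; rewrite mxE !dist_signless_laplacianE distC eq_sym.
by case: eqVneq => [->|].
Qed.

Lemma least_dist_Q_eigenvalue_le (R : rcfType) (G : sgraph) :
  (1 < #|G|)%N ->
  dist_Q_eigenvalue R G #|G| <= 2 * wiener R G / #|G|%:R - 1.
Proof.
move=> G_gt1; set m := dist_Q_eigenvalue _ _ _.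
pose T (i : 'I_#|G|) : R := (transmission (enum_val i))%:R.
have SE : 2 * wiener R G = \sum_i T i.
  by rewrite wienerE (reindex (@enum_val G predT)) //; apply: onW_bij; apply: enum_val_bij.
have pair i : (m + 1) * 2 <= T i + T (ordS i).
  (* Either the successor is i + 1, or i = n - 1 wraps to 0, which differs from i because n > 1. *)
  have neq : i != ordS i.
    apply/eqP => /(congr1 val) /=; case: i => i lti /= E.
    have [lt|ge] := ltnP i.+1 #|G|; first by move: E; rewrite modn_small // => /n_Sn.
    have eqS : i.+1 = #|G| by apply/eqP; rewrite eqn_leq lti.
    by move: E G_gt1; rewrite eqS modnn => i0; rewrite -eqS i0.
  have := least_eigenvalue_pair (dist_signless_laplacian_sym R G) neq.
  rewrite !dist_signless_laplacianE !eqxx (negbTE neq) !distxx /= -/(T i) -/(T _).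
  have : 1 <= (dist (enum_val i) (enum_val (ordS i)))%:R :> R.
    by rewrite ler1n dist_gt0 // (inj_eq enum_val_inj).
  rewrite -[nth _ _ _]/m; lra.
have n0 : 0 < #|G|%:R :> R by rewrite ltr0n ltnW.
rewrite lerBrDr ler_pdivlMr // SE.
have : \sum_(i : 'I_#|G|) (m + 1) * 2 <= \sum_i (T i + T (ordS i)).
  by apply: ler_sum.
rewrite sumr_const card_ord -mulr_natr big_split /=.
(* The cyclic successor permutes the indices, so both sums equal 2W. *)
have <- : \sum_i T i = \sum_i T (ordS i).
  by rewrite (reindex (@ordS #|G|)) //; apply: onW_bij; exact: ordS_bij.
lra.
Qed.

(** * Equality for complete graphs *)

Lemma sg_iso_complete_adj (G : sgraph) (n : nat) (u v : G) :
  sg_iso G (complete_graph n) -> adj u v = (u != v).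
Proof.
by move=> [f /bij_inj f_inj f_adj]; rewrite -f_adj /= (inj_eq f_inj).
Qed.

(** Only this direction is specific to complete graphs; the reverse inequality is the general bound.
    Here Q = (n - 2) I + J with J the all-ones matrix. *)
Lemma least_dist_Q_eigenvalue_ge_complete (R : rcfType) (G : sgraph) :
  (1 < #|G|)%N -> (forall u v : G, adj u v = (u != v)) ->
  2 * wiener R G / #|G|%:R - 1 <= dist_Q_eigenvalue R G #|G|.
Proof.
move=> G_gt1 adjE; set m := dist_Q_eigenvalue _ _ _.
have dE (u v : G) : dist u v = (u != v).
  by case: eqVneq => [->|neq]; rewrite ?distxx // dist_adj ?adjE.
have TE (u : G) : (transmission u)%:R = #|G|%:R - 1 :> R.
  rewrite /transmission (bigD1 u) //= distxx add0n.
  under eq_bigr => v neq do rewrite dE eq_sym neq.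
  by rewrite sum1_card cardC1 -subn1 natrB // ltnW.
have n0 : 0 < #|G|%:R :> R by rewrite ltr0n ltnW.
(* Every transmission is n - 1, so 2W = n (n - 1). *)
have -> : 2 * wiener R G / #|G|%:R - 1 = #|G|%:R - 2.
  have -> : 2 * wiener R G = (#|G|%:R - 1) * #|G|%:R.
    by rewrite wienerE (eq_bigr _ (fun u _ => TE u)) sumr_const mulr_natr.
  by rewrite mulfK ?gt_eqF //; ring.
have [/eigenvalueP[v vQ v0] _] :=
  least_eigenvalue (dist_signless_laplacian_sym R G) (ltnW G_gt1).
rewrite -[nth _ _ _]/m in vQ.
pose s := \sum_i v 0 i.
(* Coordinate j of v Q = m v, with (n - 2) v_j moved to the other side. *)
have row j : (m - (#|G|%:R - 2)) * v 0 j = s.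
  have := congr1 (fun M : 'rV_ _ => M 0 j) vQ; rewrite !mxE.
  rewrite (bigD1 j) //= dist_signless_laplacianE eqxx distxx TE.
  under eq_bigr => i neq do
    rewrite dist_signless_laplacianE (negbTE neq) dE (inj_eq enum_val_inj) neq
            add0r mulr1.
  have -> : s = v 0 j + \sum_(i | i != j) v 0 i by rewrite /s (bigD1 j).
  rewrite mulr1n addr0; lra.
have : (m - (#|G|%:R - 2)) * s = #|G|%:R * s.
  by rewrite [in LHS]/s mulr_sumr (eq_bigr _ (fun j _ => row j)) sumr_const card_ord mulr_natl.
(* If s is nonzero, cancelling it gives m - (n - 2) = n, which is nonnegative. If s = 0, a nonzero
   coordinate of [v] forces m = n - 2. *)
have [s0 _|s0 /(mulIf s0) E] := eqVneq s 0; last first.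
  by rewrite -subr_ge0 E ltW.
have /rV0Pn[j vj] := v0; have /eqP := row j.
by rewrite s0 mulf_eq0 (negbTE vj) orbF subr_eq0 => /eqP->.
Qed.

Theorem theorem6p4 (R : rcfType) (n : nat) (G : sgraph)
    (n_ge2 : (2 <= n)%N) (order_G : #|G| = n) (connG : connected G) :
  dist_Q_eigenvalue R G n <= 2 * wiener R G / n%:R - 1
  /\ (sg_iso G (complete_graph n) ->
      dist_Q_eigenvalue R G n = 2 * wiener R G / n%:R - 1).
Proof.
subst n; have le := least_dist_Q_eigenvalue_le R n_ge2; split=> // isoG.
apply/le_anti; rewrite le /=; apply: least_dist_Q_eigenvalue_ge_complete => // u v.
exact: sg_iso_complete_adj isoG.
Qed.
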